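(* The following eight mesh patterns $(12,R)$ are pairwise equidistributed, where $R$ ranges over: $\{(0,2),(1,2),(2,2),(1,1),(0,0)\}$, $\{(0,2),(2,2),(0,1),(1,1),(0,0)\}$, $\{(2,2),(1,1),(2,1),(0,0),(2,0)\}$, $\{(2,2),(1,1),(0,0),(1,0),(2,0)\}$, $\{(0,2),(1,2),(0,1),(2,1),(0,0)\}$, $\{(0,2),(1,2),(2,2),(0,1),(1,0)\}$, $\{(2,2),(0,1),(2,1),(1,0),(2,0)\}$, $\{(1,2),(2,1),(0,0),(1,0),(2,0)\}$.
   Context: For $R\subseteq\{0,1,2\}^2$ and $\pi=\pi_1\cdots\pi_n\in S_n$, an occurrence of the mesh pattern $(12,R)$ in $\pi$ is a pair of positions $i_1<i_2$ with $\pi_{i_1}<\pi_{i_2}$ such that, setting $x_0=0,x_1=i_1,x_2=i_2,x_3=n+1$ and $y_0=0,y_1=\pi_{i_1},y_2=\pi_{i_2},y_3=n+1$, for every $(a,b)\in R$ there is no index $k$ with $x_a<k<x_{a+1}$ and $y_b<\pi_k<y_{b+1}$. $s_{n,k}(p)$ is the number of $\pi\in S_n$ with exactly $k$ occurrences of $p$; $p_1,p_2$ are equidistributed if $s_{n,k}(p_1)=s_{n,k}(p_2)$ for all $n,k\ge 0$. *)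

(* Defs.v *)
From mathcomp Require Import all_boot all_fingroup.
Set Implicit Arguments.
Unset Strict Implicit.
Unset Printing Implicit Defensive.

(* The set R of shaded boxes (a, b), with a, b in {0, 1, 2}. *)
Definition mesh := {set 'I_3 * 'I_3}.

(* Entries outside {0, 1, 2}^2 would be ignored. *)
Definition boxes (s : seq (nat * nat)) : mesh :=
  [set c | (val c.1, val c.2) \in s].

(* The grid lines 0, u, v, n + 1, numbered from 0. *)
Definition grid_line (n u v a : nat) : nat := nth n.+1 [:: 0; u; v] a.

(* 'S_n acts on {0, ..., n-1}: i : 'I_n stands for the position i + 1, and
   the value there in one-line notation is (p i).+1. *)
Definition position n (i : 'I_n) : nat := i.+1.
Definition entry n (p : 'S_n) (i : 'I_n) : nat := (p i).+1.

Definition in_box n (p : 'S_n) (i1 i2 : 'I_n) (c : 'I_3 * 'I_3) (k : 'I_n) :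
    bool :=
  let x := grid_line n (position i1) (position i2) in
  let y := grid_line n (entry p i1) (entry p i2) in
  (x c.1 < position k < x (c.1.+1)) && (y c.2 < entry p k < y (c.2.+1)).

Definition occurrence (R : mesh) n (p : 'S_n) (i1 i2 : 'I_n) : bool :=
  [&& position i1 < position i2,
      entry p i1 < entry p i2
    & [forall c in R, ~~ [exists k, in_box p i1 i2 c k]]].

Definition num_occurrences (R : mesh) n (p : 'S_n) : nat :=
  #|[set ij : 'I_n * 'I_n | occurrence R p ij.1 ij.2]|.

(* s_{n,k} of the mesh pattern (12, R). *)
Definition s_count (R : mesh) (n k : nat) : nat :=
  #|[set p : 'S_n | num_occurrences R p == k]|.

Definition equidistributed (R1 R2 : mesh) : Prop :=
  forall n k : nat, s_count R1 n k = s_count R2 n k.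

(* Main.v *)
(* Transposition and rotation by a half turn carry 12 to itself, and they split
   the eight patterns into two orbits of size four.  The pattern with boxes
   (0,2), (1,2), (2,2), (1,1), (0,0) counts the entries x before the maximum n
   such that, among the entries before n, all those to the left of x are larger
   and all those to its right are smaller.  The pattern with boxes (0,2), (1,2),
   (2,2), (0,1), (1,0) counts those x with the two comparisons reversed.
   Reversing the prefix before n exchanges the two, which links the orbits. *)
Require Import Defs.
From mathcomp Require Import all_boot all_fingroup.
From mathcomp Require Import zify.

Set Implicit Arguments.
Unset Strict Implicit.
Unset Printing Implicit Defensive.

(** * Transfer of counts along bijections *)

Lemma equidistributed_sym R1 R2 :
  equidistributed R1 R2 -> equidistributed R2 R1.
Proof. by move=> h n k; rewrite h. Qed.

Lemma equidistributed_trans R1 R2 R3 :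
  equidistributed R1 R2 -> equidistributed R2 R3 -> equidistributed R1 R3.
Proof. by move=> h12 h23 n k; rewrite h12. Qed.

(** Injectivity suffices because ['S_n] is finite: [f] is then a bijection that preserves the level
    sets of the count. *)
Lemma eq_s_count R1 R2 n (f : 'S_n -> 'S_n) : injective f ->
  (forall p, num_occurrences R2 (f p) = num_occurrences R1 p) ->
  s_count R1 n =1 s_count R2 n.
Proof.
move=> f_inj num_f k; rewrite /s_count.
rewrite -[RHS](on_card_preimset (f := f)); last exact/onW_bij/injF_bij.
by apply: eq_card => p; rewrite !inE num_f.
Qed.

Lemma eq_num_occurrences R1 R2 n (p q : 'S_n) (g : 'I_n * 'I_n -> 'I_n * 'I_n) :
    injective g ->
    (forall i1 i2, occurrence R2 q (g (i1, i2)).1 (g (i1, i2)).2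
                   = occurrence R1 p i1 i2) ->
  num_occurrences R2 q = num_occurrences R1 p.
Proof.
move=> g_inj occ_g; rewrite /num_occurrences.
rewrite -(on_card_preimset (f := g)); last exact/onW_bij/injF_bij.
by apply: eq_card => -[i1 i2]; rewrite !inE occ_g.
Qed.

Lemma occurrenceP (R : mesh) n (p : 'S_n) (i1 i2 : 'I_n) :
  reflect [/\ i1 < i2, p i1 < p i2
            & forall c k, c \in R -> ~~ in_box p i1 i2 c k]
          (occurrence R p i1 i2).
Proof.
apply: (iffP and3P) => -[lt_i lt_p boxesR]; split=> //.
  move=> c k cR; move/forall_inP/(_ c cR): boxesR.
  by apply: contra => ck; apply/existsP; exists k.
apply/forall_inP => c cR; apply/existsP => -[k].
by apply/negP/boxesR.
Qed.

(** * Transposition of the mesh *)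

Definition mesh_tr (R : mesh) : mesh := [set c | (c.2, c.1) \in R].

Lemma mesh_trK : involutive mesh_tr.
Proof. by move=> R; apply/setP => -[a b]; rewrite !inE. Qed.

(** Inversion exchanges positions and values, hence the two coordinates of every box. One
    implication is enough: applied to the inverse it gives the converse, both operations being
    involutions. *)
Lemma occurrence_tr_imp R n (p : 'S_n) i1 i2 :
  occurrence R p i1 i2 -> occurrence (mesh_tr R) p^-1%g (p i1) (p i2).
Proof.
case/occurrenceP=> lt_i lt_p boxesR; apply/occurrenceP.
rewrite !permK; split=> // -[a b] k; rewrite inE /= => baR.
have := boxesR _ (p^-1 k)%g baR.
by rewrite /in_box /entry /position !permK permKV /= andbC.
Qed.

Lemma equidistributed_tr R : equidistributed R (mesh_tr R).
Proof.
move=> n; apply: (@eq_s_count _ _ _ (fun p => p^-1%g)); first exact: invg_inj.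
move=> p; apply: (@eq_num_occurrences _ _ _ _ _ (fun ij => (p ij.1, p ij.2))).
  by move=> [i1 i2] [j1 j2] [/perm_inj -> /perm_inj ->].
move=> i1 i2; apply/idP/idP; last exact: occurrence_tr_imp.
by move/occurrence_tr_imp; rewrite mesh_trK invgK !permK.
Qed.

(** * Rotation by a half turn *)

Definition mesh_rot (R : mesh) : mesh :=
  [set c | (rev_ord c.1, rev_ord c.2) \in R].

Lemma mesh_rotK : involutive mesh_rot.
Proof. by move=> R; apply/setP => -[a b]; rewrite !inE !rev_ordK. Qed.

Definition rev_perm n : 'S_n := perm (@rev_ord_inj n).

Definition rot_perm n (p : 'S_n) : 'S_n := (rev_perm n * p * rev_perm n)%g.

Lemma rot_permE n (p : 'S_n) i : rot_perm p i = rev_ord (p (rev_ord i)).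
Proof. by rewrite !permM !permE. Qed.

Lemma rot_permK n : involutive (@rot_perm n).
Proof. by move=> p; apply/permP => i; rewrite !rot_permE !rev_ordK. Qed.

(** The reflection t -> n + 1 - t reverses the order of the four grid lines, so strip a becomes
    strip 2 - a, which is [rev_ord a] in ['I_3]. *)
Lemma grid_line_rev n (u v k : 'I_n) (a : 'I_3) :
  let x := grid_line n (rev_ord v).+1 (rev_ord u).+1 in
  let y := grid_line n u.+1 v.+1 in
  (x a < (rev_ord k).+1 < x a.+1) = (y (rev_ord a) < k.+1 < y (rev_ord a).+1).
Proof.
have := (ltn_ord u, ltn_ord v, ltn_ord k) => -[[]].
by case: a => [[|[|[|a]]] //= a3]; rewrite /grid_line /=; lia.
Qed.

Lemma in_box_rot n (p : 'S_n) i1 i2 c k :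
  in_box (rot_perm p) (rev_ord i2) (rev_ord i1) c (rev_ord k)
  = in_box p i1 i2 (rev_ord c.1, rev_ord c.2) k.
Proof. by rewrite /in_box /entry !rot_permE !rev_ordK !grid_line_rev. Qed.

Lemma occurrence_rot_imp R n (p : 'S_n) i1 i2 :
  occurrence R p i1 i2 ->
  occurrence (mesh_rot R) (rot_perm p) (rev_ord i2) (rev_ord i1).
Proof.
case/occurrenceP=> lt_i lt_p boxesR; apply/occurrenceP.
rewrite !rot_permE !rev_ordK; split.
- by rewrite /=; have := ltn_ord i2; lia.
- by rewrite /=; have := ltn_ord (p i2); lia.
move=> c k; rewrite inE => cR.
by rewrite -[k]rev_ordK in_box_rot; apply: boxesR.
Qed.

Lemma equidistributed_rot R : equidistributed R (mesh_rot R).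
Proof.
move=> n; apply: (@eq_s_count _ _ _ (@rot_perm n)).
  exact: can_inj (@rot_permK n).
move=> p.
apply: (@eq_num_occurrences _ _ _ _ _ (fun ij => (rev_ord ij.2, rev_ord ij.1))).
  by apply: inv_inj => -[i1 i2]; rewrite /= !rev_ordK.
move=> i1 i2; apply/idP/idP; last exact: occurrence_rot_imp.
by move/occurrence_rot_imp; rewrite mesh_rotK rot_permK !rev_ordK.
Qed.

(** * Reversal of the prefix before the maximum *)

Definition rev_below n (j i : 'I_n.+1) : 'I_n.+1 :=
  if i < j then inord (j - i.+1) else i.

Lemma rev_belowE n (j i : 'I_n.+1) :
  rev_below j i = (if i < j then j - i.+1 else i) :> nat.
Proof.
(* The value j - (i + 1) stays below j, so [inord] never falls back on its default. *)
by rewrite /rev_below; case: ifP => // _; rewrite inordK //; have := ltn_ord j; lia.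
Qed.

Lemma rev_belowK n (j : 'I_n.+1) : involutive (rev_below j).
Proof.
move=> i; apply/val_inj; rewrite /= !rev_belowE.
case: (ltnP i j) => [ij|]; last by case: ltnP.
by rewrite ifT; lia.
Qed.

Lemma rev_below_id n (j : 'I_n.+1) : rev_below j j = j.
Proof. by apply/val_inj; rewrite /= rev_belowE ltnn. Qed.

Definition rev_prefix n (p : 'S_n.+1) : 'S_n.+1 :=
  (perm (can_inj (rev_belowK (p^-1 ord_max))) * p)%g.

Lemma rev_prefixE n (p : 'S_n.+1) j i :
  p j = ord_max -> rev_prefix p i = p (rev_below j i).
Proof. by move=> pj; rewrite permM permE -pj permK. Qed.

Lemma rev_prefix_max n (p : 'S_n.+1) j :
  p j = ord_max -> rev_prefix p j = ord_max.
Proof. by move=> pj; rewrite (rev_prefixE _ pj) rev_below_id. Qed.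

(** The maximum does not move, so the second application reverses the same prefix as the first. *)
Lemma rev_prefixK n : involutive (@rev_prefix n).
Proof.
move=> p; have pj := permKV p ord_max.
apply/permP => i; rewrite (rev_prefixE _ (rev_prefix_max pj)).
by rewrite (rev_prefixE _ pj) rev_belowK.
Qed.

(** * Occurrences when the top row is shaded *)

Lemma occurrence_boxesP (s : seq (nat * nat)) n (p : 'S_n) (i1 i2 : 'I_n) :
    all [pred c | (c.1 < 3) && (c.2 < 3)] s ->
  reflect [/\ i1 < i2, p i1 < p i2
            & forall k : 'I_n, all [pred c |
                ~~ ((grid_line n i1.+1 i2.+1 c.1 < k.+1
                       < grid_line n i1.+1 i2.+1 c.1.+1)
                 && (grid_line n (p i1).+1 (p i2).+1 c.2 < (p k).+1
                       < grid_line n (p i1).+1 (p i2).+1 c.2.+1))] s]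
          (occurrence (boxes s) p i1 i2).
Proof.
move=> s3; apply: (iffP (occurrenceP _ _ _ _)) => -[lt_i lt_p boxes_s]; split=> //.
  move=> k; apply/allP => -[a b] abs.
  have /andP[/= a3 b3] := allP s3 _ abs.
  by apply: (boxes_s (Ordinal a3, Ordinal b3) k); rewrite inE.
by move=> c k; rewrite inE => cs; apply: (allP (boxes_s k) _ cs).
Qed.

(** An empty top row forces the second point to be the maximum. Row 0 or 1 of any other entry is
    then decided by comparing it with [p i1] alone. *)
Lemma occurrence_topP (s : seq (nat * nat)) n (p : 'S_n.+1) (i1 i2 : 'I_n.+1) :
    all [pred c | (c.1 < 3) && (c.2 < 2)] s ->
  reflect [/\ i1 < i2, p i2 = ord_max
            & forall k : 'I_n.+1, k != i1 -> k != i2 -> all [pred c |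
                ~~ ((grid_line n.+1 i1.+1 i2.+1 c.1 < k.+1
                       < grid_line n.+1 i1.+1 i2.+1 c.1.+1)
                 && ((p k < p i1) == (c.2 == 0)))] s]
          (occurrence (boxes [:: (0, 2), (1, 2), (2, 2) & s]) p i1 i2).
Proof.
move=> s2.
have s3 : all [pred c | (c.1 < 3) && (c.2 < 3)] [:: (0, 2), (1, 2), (2, 2) & s].
  by rewrite /=; apply: sub_all s2 => -[a b] /= /andP[-> /ltnW].
have neq (k l : 'I_n.+1) : k != l -> (p k : nat) != p l.
  by rewrite (inj_eq val_inj) (inj_eq perm_inj).
apply: (iffP (occurrence_boxesP _ _ _ s3)) => -[lt_i].
  move=> lt_p cells.
  have max_i2 : p i2 = ord_max.
    (* Were the maximum at a position [m] other than [i2], it would differ from [i1] too and lie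
       inside one of the three shaded boxes of the top row. *)
    set m := (p^-1 ord_max)%g; have pm : p m = ord_max by rewrite permKV.
    rewrite -pm; congr (p _); apply/eqP/negPn/negP => m2.
    have m1 : m != i1.
      by apply: contraTneq lt_p => <-; rewrite pm -leqNgt -ltnS ltn_ord.
    have /= := cells m; rewrite pm /grid_line /=.
    have := neq _ _ m2; rewrite pm /= => p2.
    move: m1 m2; rewrite -!(inj_eq val_inj) /=.
    have := (ltn_ord (p i2), ltn_ord m, ltn_ord i2) => -[[]].
    lia.
  split=> // k k1 k2; apply/allP => -[a b] abs /=.
  have /= /and4P[_ _ _ /allP/(_ _ abs) /=] := cells k.
  have /andP[/= _ b2] := allP s2 _ abs.
  apply: contra => /andP[-> /=].
  have := neq _ _ k1; have := neq _ _ k2.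
  rewrite max_i2 /=; have := ltn_ord (p k).
  case: b b2 {abs} => [|[|]] //= _; rewrite /grid_line /=; lia.
move=> max_i2 cells; have neq1 : i1 != i2 by rewrite -(inj_eq val_inj) neq_ltn lt_i.
have lt_p : p i1 < p i2.
  by have := neq _ _ neq1; rewrite max_i2 /=; have := ltn_ord (p i1); lia.
split=> // k; apply/allP => -[a b] ab.
have /andP[/= a3 b3] := allP s3 _ ab.
(* The two chosen points lie on grid lines, hence in no open strip. *)
have [->|k1] := eqVneq k i1.
  by move: a a3 lt_i {ab} => [|[|[|a]]] //= _; rewrite /grid_line /=; lia.
have [->|k2] := eqVneq k i2.
  by move: a a3 lt_i {ab} => [|[|[|a]]] //= _; rewrite /grid_line /=; lia.
case: b b3 ab => [|[|[|b]]] //= _; rewrite !inE !xpair_eqE ?andbF //=.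
- move=> /(allP (cells k k1 k2)) /=; apply: contra => /andP[-> /=].
  by rewrite /grid_line /=; lia.
- move=> /(allP (cells k k1 k2)) /=; apply: contra => /andP[-> /=].
  by rewrite /grid_line /=; lia.
move=> _; rewrite max_i2 /grid_line /=; have := ltn_ord (p k); lia.
Qed.

(** Reversing the prefix exchanges columns 0 and 1 and keeps all values. The map 1 - c on columns
    swaps the two admissible lists, so this one implication serves both directions. *)
Lemma occurrence_rev_prefix (s1 s2 : seq (nat * nat)) n (p : 'S_n.+1) i1 i2 :
    s1 \in [:: [:: (1, 1); (0, 0)]; [:: (0, 1); (1, 0)]] ->
    s2 = [seq (1 - c.1, c.2) | c <- s1] ->
  occurrence (boxes [:: (0, 2), (1, 2), (2, 2) & s1]) p i1 i2 ->
  occurrence (boxes [:: (0, 2), (1, 2), (2, 2) & s2]) (rev_prefix p)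
    (rev_below (p^-1 ord_max)%g i1) (rev_below (p^-1 ord_max)%g i2).
Proof.
rewrite !inE => /orP s1_in s2E.
have [s1_lt s2_lt] : all [pred c | (c.1 < 3) && (c.2 < 2)] s1 /\
                     all [pred c | (c.1 < 3) && (c.2 < 2)] s2.
  by rewrite s2E; case: s1_in => /eqP->.
case/(occurrence_topP _ _ _ s1_lt) => lt_i max_i2 cells.
have -> : (p^-1 ord_max)%g = i2 by rewrite -max_i2 permK.
rewrite rev_below_id; apply/(occurrence_topP _ _ _ s2_lt); split.
- by rewrite rev_belowE lt_i; lia.
- exact: rev_prefix_max.
(* Every position is the image of one in [p], where the hypothesis [cells] applies. *)
move=> k; rewrite -[k](rev_belowK i2); move: (rev_below i2 k) => {}k.
rewrite !(rev_prefixE _ max_i2) !rev_belowK.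
have -> : (rev_below i2 k != rev_below i2 i1) = (k != i1).
  by rewrite (inj_eq (can_inj (rev_belowK i2))).
have -> : (rev_below i2 k != i2) = (k != i2).
  by rewrite -(inj_eq (can_inj (rev_belowK i2))) rev_belowK rev_below_id.
move=> k1 k2; have := cells k k1 k2; rewrite s2E.
move: k1 k2; rewrite -!(inj_eq val_inj) /=.
have := (ltn_ord k, ltn_ord i2) => -[].
rewrite /grid_line !rev_belowE lt_i.
(* Positions beyond [i2] are in column 2, where neither list has a box. *)
by case: (ltnP k i2) => ki; case: s1_in => /eqP-> /=; lia.
Qed.

Lemma equidistributed_reversal :
  equidistributed (boxes [:: (0, 2); (1, 2); (2, 2); (1, 1); (0, 0)])
                  (boxes [:: (0, 2); (1, 2); (2, 2); (0, 1); (1, 0)]).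
Proof.
case=> [|n] k.
  (* For n = 0 there is no maximum, but also no pair of positions to count. *)
  apply: eq_card => p; rewrite !inE; congr (_ == k).
  by apply: eq_card => -[[]].
apply: (@eq_s_count _ _ _ (@rev_prefix n)).
  exact: inv_inj (@rev_prefixK n).
move=> p; set j := (p^-1 ord_max)%g.
have pj : p j = ord_max by rewrite permKV.
apply: (@eq_num_occurrences _ _ _ _ _
          (fun ij => (rev_below j ij.1, rev_below j ij.2))).
  by apply: inv_inj => -[i1 i2]; rewrite /= !rev_belowK.
move=> i1 i2; apply/idP/idP => /=.
  (* The converse is the same lemma for [rev_prefix p], whose maximum is still at [j]. *)
  move/(occurrence_rev_prefix (s2 := [:: (1, 1); (0, 0)])).
  rewrite -(rev_prefix_max pj) permK rev_prefixK !rev_belowK.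
  by apply.
by apply: occurrence_rev_prefix.
Qed.

(** * The symmetries on explicit lists of boxes, up to reordering *)

Lemma equidistributed_boxes_tr (s t : seq (nat * nat)) :
  perm_eq t [seq (c.2, c.1) | c <- s] -> equidistributed (boxes s) (boxes t).
Proof.
move=> /perm_mem ts; suff -> : boxes t = mesh_tr (boxes s).
  exact: equidistributed_tr.
apply/setP => -[a b]; rewrite !inE ts.
by rewrite -[RHS](mem_map (f := fun c => (c.2, c.1))) // => -[? ?] [? ?] [-> ->].
Qed.

(** The bound on [s] matters because subtraction is truncated: an ignored entry such as (3, 0) would
    be sent to the genuine box (0, 2). *)
Lemma equidistributed_boxes_rot (s t : seq (nat * nat)) :
    all [pred c | (c.1 < 3) && (c.2 < 3)] s ->
    perm_eq t [seq (2 - c.1, 2 - c.2) | c <- s] ->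
  equidistributed (boxes s) (boxes t).
Proof.
move=> s3 /perm_mem ts; suff -> : boxes t = mesh_rot (boxes s).
  exact: equidistributed_rot.
apply/setP => -[a b]; rewrite !inE ts /= !subSS.
apply/mapP/idP => [[[c d] cds [-> ->]]|abs].
  by have /andP[/= c3 d3] := allP s3 _ cds; rewrite !subKn.
exists (2 - a, 2 - b) => //=.
by have := (ltn_ord a, ltn_ord b) => -[a3 b3]; rewrite !subKn.
Qed.

Theorem theorem3p10 (R1 R2 : mesh) :
  let patterns : seq mesh :=
    [:: boxes [:: (0, 2); (1, 2); (2, 2); (1, 1); (0, 0)];
        boxes [:: (0, 2); (2, 2); (0, 1); (1, 1); (0, 0)];
        boxes [:: (2, 2); (1, 1); (2, 1); (0, 0); (2, 0)];
        boxes [:: (2, 2); (1, 1); (0, 0); (1, 0); (2, 0)];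
        boxes [:: (0, 2); (1, 2); (0, 1); (2, 1); (0, 0)];
        boxes [:: (0, 2); (1, 2); (2, 2); (0, 1); (1, 0)];
        boxes [:: (2, 2); (0, 1); (2, 1); (1, 0); (2, 0)];
        boxes [:: (1, 2); (2, 1); (0, 0); (1, 0); (2, 0)]] in
  R1 \in patterns -> R2 \in patterns -> equidistributed R1 R2.
Proof.
move=> patterns.
set P := boxes [:: (0, 2); (1, 2); (2, 2); (1, 1); (0, 0)].
suff equi_P R : R \in patterns -> equidistributed P R.
  by move=> /equi_P/equidistributed_sym h1 /equi_P; apply: equidistributed_trans.
have tr := equidistributed_boxes_tr; have rot := equidistributed_boxes_rot.
have trans := equidistributed_trans; have PQ := equidistributed_reversal.
have P_tr : equidistributed P
    (boxes [:: (2, 2); (1, 1); (2, 1); (0, 0); (2, 0)]) by apply: tr.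
have PQ_tr : equidistributed P
    (boxes [:: (2, 2); (0, 1); (2, 1); (1, 0); (2, 0)]).
  by apply: trans PQ _; apply: tr.
(* In list order: [P], its rotated transpose, its transpose, its rotation; then, for the pattern
   reached by [PQ], the rotated transpose, the pattern itself, its transpose, its rotation. *)
rewrite !inE; case/or4P => [| | |/or4P[| | |/orP[]]] /eqP->.
- by [].
- by apply: trans P_tr _; apply: rot.
- exact: P_tr.
- by apply: rot.
- by apply: trans PQ_tr _; apply: rot.
- exact: PQ.
- exact: PQ_tr.
- by apply: trans PQ _; apply: rot.
Qed.
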